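(* Let $r\geq 2$ be an integer, let $n$ be a positive integer, and let $c,\varepsilon$ be real numbers with $1/\ln n<c<r^{-3(r+14)(r+1)}$ and $0<\varepsilon<r^{-24}$. Let $G$ be a graph of order $n$. If $G$ has $\left\lceil (1-1/r-\varepsilon)n^{2}/2\right\rceil$ edges, then $G$ satisfies at least one of the following conditions: (a) $G$ contains a $K_{r+1}\left(\lfloor c\ln n\rfloor,\ldots,\lfloor c\ln n\rfloor,\left\lceil n^{1-\sqrt{c}}\right\rceil\right)$ (with $r$ parts of size $\lfloor c\ln n\rfloor$ and one part of size $\lceil n^{1-\sqrt{c}}\rceil$); (b) $G$ differs from $T_{r}(n)$ in fewer than $\left(\varepsilon^{1/3}+c^{1/(3r+3)}\right)n^{2}$ edges.
   Context: Graphs are finite, simple and undirected; the order of a graph is its number of vertices; $\ln$ is the natural logarithm (the hypothesis $1/\ln n<c$ is understood with $n\geq 2$, so that $\ln n>0$). $K_{r}(s_{1},\ldots,s_{r})$ denotes the complete $r$-partite graph with parts of size $s_{1},\ldots,s_{r}$. ''$G$ contains $F$'' means that $G$ has a (not necessarily induced) subgraph isomorphic to $F$. $T_{r}(n)$ denotes the $r$-partite Turán graph of order $n$, i.e. the complete $r$-partite graph on $n$ vertices whose part sizes differ pairwise by at most $1$. ''$G$ differs from $T_r(n)$ in fewer than $m$ edges'' means that there is a graph $T$ on the vertex set $V(G)$, isomorphic to $T_r(n)$, such that the symmetric difference of the edge sets $E(G)$ and $E(T)$ has fewer than $m$ elements (i.e. $G$ can be transformed into a copy of $T_r(n)$ by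 adding and deleting fewer than $m$ edges in total). *)

(* Defs.v *)
From mathcomp Require Import all_boot.

Set Implicit Arguments.
Unset Strict Implicit.
Unset Printing Implicit Defensive.

Record sgraph (V : finType) := SGraph {
  adj :> rel V;
  adj_sym : symmetric adj;
  adj_irr : irreflexive adj }.

Section Graphs.
Variables V W : finType.

Definition edges (G : sgraph V) : {set {set V}} :=
  [set [set p.1; p.2] | p : V * V & G p.1 p.2].

(* Not necessarily induced. *)
Definition contains (G : sgraph V) (F : sgraph W) : Prop :=
  exists f : W -> V, injective f /\ (forall x y, F x y -> G (f x) (f y)).

Definition isomorphic (G : sgraph V) (F : sgraph W) : Prop :=
  exists f : W -> V, bijective f /\ (forall x y, F x y = G (f x) (f y)).

Definition edge_diff (G H : sgraph V) : nat :=
  #|(edges G :\: edges H) :|: (edges H :\: edges G)|.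

End Graphs.

Section Multipartite.
Variables (r : nat) (s : 'I_r -> nat).

(* The part with index i is 'I_(s i); a vertex is a part together with an
   element of it. Parts of size 0 are allowed. *)
Definition kpart_vertex : finType := {i : 'I_r & 'I_(s i)}.

Definition kpart_adj : rel kpart_vertex := fun u v => tag u != tag v.

Lemma kpart_sym : symmetric kpart_adj.
Proof. by move=> u v; rewrite /kpart_adj eq_sym. Qed.

Lemma kpart_irr : irreflexive kpart_adj.
Proof. by move=> u; rewrite /kpart_adj eqxx. Qed.

Definition kpart : sgraph kpart_vertex := SGraph kpart_sym kpart_irr.

End Multipartite.

(* T is a copy of the r-partite Turan graph of order n; when n < r some parts
   are empty. *)
Definition is_turan (r n : nat) (V : finType) (T : sgraph V) : Prop :=
  exists s : 'I_r -> nat,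
    [/\ \sum_(i < r) s i = n,
        forall i j, s i <= s j + 1
      & isomorphic T (kpart s)].

Definition part_sizes (r a b : nat) : 'I_r.+1 -> nat :=
  fun i => if i < r then a else b.

Arguments part_sizes : clear implicits.

(* Main.v *)
Require Import Defs.
From mathcomp Require Import all_boot all_order all_algebra.
From mathcomp Require Import reals sequences exp.
From mathcomp Require Import ring lra zify.
Set Implicit Arguments.
Unset Strict Implicit.
Unset Printing Implicit Defensive.
Import Order.TTheory GRing.Theory Num.Theory.

(** Write k_s for the number of s-cliques of G, d(L) for the number of common
    neighbours of a clique L, and g = c `^ (1 / (3r + 3)), e = eps `^ (1/3), so
    that c = g ^ (3r + 3) and eps = e ^ 3.  The proof is a dichotomy on whether
    k_(r+1) exceeds a constant times r g^3 n^(r+1).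

    Many (r+1)-cliques force the large complete multipartite subgraph.  A dense
    set M of (k+1)-tuples projects to the dense set M' of those k-tuples that
    have linearly many extensions in M.  By induction M' contains m tuples that
    together span a complete k-partite graph.  Each of them has linearly many
    extensions, so by pigeonhole over the subsets of the m tuples, some s of
    them share at least n / (q 2^m) extensions, where m = q s and 1 / q is the
    density up to a factor of order k ([many_tuples_blowup]).  Each step costs a
    factor q in the part sizes; with q of order g^-3 and s = c ln n, all r steps
    fit below ln n, and the last part keeps n^(1 - sqrt c) vertices
    ([blowup_sizes], [many_cliques_contain]).

    Few (r+1)-cliques force G to be close to a Turan graph.  For an r-clique K
    and x in K, let W_x be the set of vertices joined to all of K except x.  The
    sets W_x are disjoint, an edge inside W_x extends K \ x to an (r+1)-clique,
    and the vertices in no W_x are few on average, because the sum of d(L)^2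
    over (r-1)-cliques L is large: the Moon-Moser inequality propagates the edge
    density up to k_r / k_(r-1) ([moon_moser], [cliques_growth]).  Averaging over
    K yields a partition into r parts with few edges inside the parts
    ([good_partition], [near_partition]).  The number of edges then forces the
    parts to be nearly equal, by comparison of sum |V_i|^2 with n^2 / r, and
    nearly completely joined, and moving few vertices makes the parts exactly
    balanced ([turan_close], [stability_few_cliques]).

    The exponents in the hypotheses make both e r^8 and g r^(r+14) less than 1,
    which absorbs every constant that depends on r ([near_turan_bounds]). *)

(** * Cliques and common neighbourhoods *)

Section Cliques.
Variables (V : finType) (G : sgraph V).
Implicit Types (x y u v : V) (K L A : {set V}).

Definition common_nbrs A : {set V} := [set v | [forall x in A, G x v]].

Definition cliques s : {set {set V}} :=
  [set K : {set V} | (#|K| == s) && [forall x in K, forall y in K, (x != y) ==> G x y]].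

Lemma common_nbrsP A v : reflect (forall x, x \in A -> G x v) (v \in common_nbrs A).
Proof. by rewrite inE; apply: forall_inP. Qed.

Lemma cliquesP s K :
  reflect (#|K| = s /\ {in K &, forall x y, x != y -> G x y}) (K \in cliques s).
Proof.
rewrite inE; apply: (iffP andP) => [[/eqP sK adjK]|[sK adjK]]; split=> //.
- by move=> x y xK yK; have /forall_inP/(_ y yK)/implyP := forall_inP adjK x xK.
- exact/eqP.
by apply/forall_inP=> x xK; apply/forall_inP=> y yK; apply/implyP; apply: adjK.
Qed.

Lemma common_nbrs_notin A v : v \in common_nbrs A -> v \notin A.
Proof. by move/common_nbrsP=> Av; apply/negP=> /Av; rewrite adj_irr. Qed.

Lemma common_nbrs0 : common_nbrs set0 = setT.
Proof. by apply/setP=> v; rewrite !inE; apply/forall_inP=> x; rewrite inE. Qed.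

Lemma common_nbrsU1 A u v : (v \in common_nbrs (u |: A)) = G u v && (v \in common_nbrs A).
Proof.
apply/common_nbrsP/andP=> [H|[Guv /common_nbrsP Av] x].
  by split; [apply: H; rewrite setU11 | apply/common_nbrsP=> x xA; apply: H; rewrite setU1r].
by case/setU1P=> [-> //|]; apply: Av.
Qed.

Lemma cliqueU1 s L x : L \in cliques s -> x \in common_nbrs L -> x |: L \in cliques s.+1.
Proof.
move=> /cliquesP[sL adjL] xL; have xnL := common_nbrs_notin xL.
move/common_nbrsP: xL => xL; apply/cliquesP; split; first by rewrite cardsU1 xnL sL.
move=> u v /setU1P[->|uL] /setU1P[->|vL]; rewrite ?eqxx //.
- by move=> _; rewrite adj_sym; apply: xL.
- by move=> _; apply: xL.
exact: adjL.
Qed.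

Lemma cliqueD1 s K x : K \in cliques s.+1 -> x \in K ->
  (K :\ x \in cliques s) && (x \in common_nbrs (K :\ x)).
Proof.
move=> /cliquesP[sK adjK] xK; apply/andP; split.
  apply/cliquesP; split; first by move: sK; rewrite (cardsD1 x) xK; case.
  by move=> u v /setD1P[_ uK] /setD1P[_ vK]; apply: adjK.
by apply/common_nbrsP=> y /setD1P[yx yK]; apply: adjK.
Qed.

(** Double counting of the pairs of a clique and one of its vertices; every
    identity between clique counts below is an instance with a chosen weight. *)
Lemma sum_clique_flags s (f : {set V} -> V -> nat) :
  \sum_(K in cliques s.+1) \sum_(x in K) f (K :\ x) x =
  \sum_(L in cliques s) \sum_(x in common_nbrs L) f L x.
Proof.
rewrite !pair_big_dep /=.
rewrite (reindex_onto (fun p : {set V} * V => (p.2 |: p.1, p.2))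
                      (fun p => (p.1 :\ p.2, p.2))) /=; last first.
  by case=> K x /= /andP[_ xK]; rewrite setD1K.
have E (L : {set V}) x :
  [&& x |: L \in cliques s.+1, x \in x |: L & ((x |: L) :\ x, x) == (L, x)] =
  (L \in cliques s) && (x \in common_nbrs L).
  apply/idP/idP=> [/and3P[cK xK /eqP[eL]]|/andP[cL xL]].
    by have := cliqueD1 cK xK; rewrite eL.
  by rewrite cliqueU1 // setU11 setU1K ?eqxx // common_nbrs_notin.
apply: eq_big => [[L x] /=|[L x] /=]; first by rewrite -andbA E.
by rewrite -andbA E => /andP[_ xL]; rewrite setU1K // common_nbrs_notin.
Qed.

Lemma sum_card_common_nbrs s :
  \sum_(L in cliques s) #|common_nbrs L| = s.+1 * #|cliques s.+1|.
Proof.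
under eq_bigr do rewrite -sum1_card.
rewrite -(sum_clique_flags s (fun _ _ => 1)).
rewrite mulnC -sum_nat_const; apply: eq_bigr => K /cliquesP[sK _].
by rewrite sum1_card.
Qed.

Lemma cliques0 : cliques 0 = [set set0].
Proof.
apply/setP=> K; rewrite [in RHS]inE; apply/cliquesP/eqP=> [[/eqP]|->].
  by rewrite cards_eq0 => /eqP.
by rewrite cards0; split=> // x y; rewrite inE.
Qed.

Lemma card_cliques1 : #|cliques 1| = #|V|.
Proof.
by rewrite -[LHS]mul1n -sum_card_common_nbrs cliques0 big_set1 common_nbrs0 cardsT.
Qed.

(** The vertices joined to all of [K] but exactly one vertex of [K]. Vertices of
    [K] itself qualify when [K] is a clique, since a graph has no loops. *)
Definition near_nbrs K : {set V} :=
  (\bigcup_(x in K) common_nbrs (K :\ x)) :\: common_nbrs K.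

Lemma common_nbrsD1 K x v : x \in K -> v \in common_nbrs (K :\ x) ->
  v \notin common_nbrs K -> ~~ G x v.
Proof.
by move=> xK vKx; apply: contra => Gxv; rewrite -(setD1K xK) common_nbrsU1 Gxv.
Qed.

(** A common neighbour of [K] is counted once for each [x] in [K]; any other
    vertex that is counted misses exactly one vertex of [K], which is the only
    [x] that counts it. *)
Lemma sum_common_nbrsD1 K :
  \sum_(x in K) #|common_nbrs (K :\ x)| = #|near_nbrs K| + #|K| * #|common_nbrs K|.
Proof.
under eq_bigr do rewrite -sum1_card.
rewrite (exchange_big_dep predT) //= -(sum1_card (mem (near_nbrs K))) mulnC -sum_nat_const.
rewrite [X in _ = X + _]big_mkcond [X in _ = _ + X]big_mkcond -big_split /=.
apply: eq_bigr => v _; rewrite inE sum1_card.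
have [vK|vK] /= := boolP (v \in common_nbrs K).
  rewrite add0n; apply: eq_card => x; apply/andP/idP=> [[]|xK] //; split=> //.
  by apply/common_nbrsP=> y /setD1P[_ yK]; apply: (common_nbrsP _ _ vK).
rewrite addn0; case: bigcupP => [[x xK vKx]|H].
  rewrite -(card1 x); apply: eq_card => y.
  have Gxv := common_nbrsD1 xK vKx vK.
  apply/andP/eqP=> /= [[yK vKy]|->]; last by [].
  apply/eqP; apply: contraNT Gxv => yx.
  by apply: (common_nbrsP _ _ vKy); rewrite !inE eq_sym yx.
apply: eq_card0 => x; apply/negP=> /andP[/= xK vKx].
by apply: H; exists x.
Qed.

Lemma card_near_nbrs_common K : #|near_nbrs K| + #|common_nbrs K| <= #|V|.
Proof.
rewrite -cardsUI (_ : _ :&: _ = set0) ?cards0 ?addn0 ?max_card //.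
by apply/setP=> v; rewrite !inE; case: forall_inP; rewrite ?andbF //=.
Qed.

Lemma sum_sqr_common_nbrs s :
  \sum_(L in cliques s) #|common_nbrs L| ^ 2 =
  \sum_(K in cliques s.+1) #|near_nbrs K| + s.+1 * (s.+2 * #|cliques s.+2|).
Proof.
under eq_bigr do rewrite expnS expn1 -sum_nat_const.
rewrite -(sum_clique_flags s (fun L _ => #|common_nbrs L|)).
rewrite -sum_card_common_nbrs big_distrr /= -big_split.
by apply: eq_bigr => K /cliquesP[sK _] /=; rewrite sum_common_nbrsD1 sK.
Qed.

(** Combining [sum_common_nbrsD1] over all cliques [K] with the disjointness of
    [near_nbrs K] and [common_nbrs K], which turns the coefficient [s.+1] into
    [s]. *)
Lemma moon_moser s :
  \sum_(L in cliques s) #|common_nbrs L| ^ 2 <=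
  #|V| * #|cliques s.+1| + s * (s.+2 * #|cliques s.+2|).
Proof.
rewrite sum_sqr_common_nbrs mulSn addnA leq_add2r -sum_card_common_nbrs -big_split /=.
rewrite mulnC -sum_nat_const; apply: leq_sum => K _.
exact: card_near_nbrs_common.
Qed.

(** An edge between common neighbours of [L] extends [L] by two vertices, so an
    ordered edge is an ordered choice of two vertices in a clique of size
    [s.+2]. *)
Lemma sum_edges_in_common_nbrs s :
  \sum_(L in cliques s) #|[set p : V * V | [&& G p.1 p.2, p.1 \in common_nbrs L
     & p.2 \in common_nbrs L]]| = s.+1 * (s.+2 * #|cliques s.+2|).
Proof.
rewrite -sum_card_common_nbrs big_distrr /=.
transitivity (\sum_(K in cliques s.+1) \sum_(x in K) #|common_nbrs (x |: (K :\ x))|); last first.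
  apply: eq_bigr => K /cliquesP[sK _]; rewrite -sK -sum_nat_const.
  by apply: eq_bigr => x xK; rewrite setD1K.
rewrite (sum_clique_flags s (fun L x => #|common_nbrs (x |: L)|)).
apply: eq_bigr => L _.
rewrite -sum1_card (eq_bigl (fun p : V * V => (p.1 \in common_nbrs L) && (p.2 \in common_nbrs (p.1 |: L)))); last first.
  by move=> [x y]; rewrite inE /= common_nbrsU1 andbCA.
rewrite -(pair_big_dep (fun x => x \in common_nbrs L) (fun x y => y \in common_nbrs (x |: L)) (fun _ _ => 1)) /=.
by apply: eq_bigr => x _; rewrite sum1_card.
Qed.

End Cliques.

(** * Blow-ups of dense families of tuples *)

(** Double counting shows that at least [#|V| / q] points lie in at least [s] of
    the sets; classifying these points by the exact collection of sets that
    contain them, some collection has its share of the [2 ^ m] available. *)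
Lemma popular_intersection (V : finType) m q s (F : 'I_m -> {set V}) :
  0 < m -> m = q * s -> (forall j, 2 * #|V| <= q * #|F j|) ->
  exists S : {set 'I_m},
    s <= #|S| /\ #|V| <= #|\bigcap_(j in S) F j| * (q * 2 ^ m).
Proof.
move=> m_gt0 mE F_large; pose D v := [set j | v \in F j].
have sum_D : \sum_v #|D v| = \sum_j #|F j|.
  under eq_bigr do rewrite -sum1_card.
  under [in RHS]eq_bigr do rewrite -sum1_card.
  rewrite (exchange_big_dep predT) //=.
  by apply: eq_bigr => j _; apply: eq_bigl => v; rewrite !inE.
pose B := [set v | s <= #|D v|].
have le_D : \sum_v #|D v| <= m * #|B| + s * #|V|.
  rewrite -[#|B|]sum1_card -[#|V|]sum1_card !big_distrr [X in X + _]big_mkcond -big_split /=.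
  apply: leq_sum => v _; rewrite inE !muln1; case: (leqP s #|D v|) => [_|/ltnW] //.
  by apply: leq_trans (max_card _) _; rewrite card_ord leq_addr.
have ge_F : m * (2 * #|V|) <= q * \sum_j #|F j|.
  rewrite big_distrr -[m in m * _]card_ord -sum_nat_const.
  exact: leq_sum.
have B_large : #|V| <= q * #|B|.
  rewrite -(leq_pmul2l m_gt0).
  have := leq_trans ge_F (leq_mul (leqnn q) _); rewrite -sum_D => /(_ _ le_D).
  rewrite mulnDr [q * (m * _)]mulnCA [q * (s * _)]mulnA -mE mul2n -addnn mulnDr.
  by rewrite leq_add2r.
have [/existsP[S /andP[sS ?]]|] := boolP [exists S : {set 'I_m}, (s <= #|S|) &&
    (#|V| <= #|\bigcap_(j in S) F j| * (q * 2 ^ m))]; first by exists S.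
rewrite negb_exists => /forallP none; exfalso.
have V_gt0 : 0 < #|V|.
  move: (none setT); rewrite cardsT card_ord [X in s <= X]mE leq_pmull; last by case: (q) mE m_gt0 => // ->.
  by case: #|V|.
suff: #|B| * (q * 2 ^ m) <= 2 ^ m * #|V|.-1.
  rewrite mulnA mulnC leq_pmul2l ?expn_gt0 // mulnC => /(leq_trans B_large); lia.
have -> : 2 ^ m * #|V|.-1 = \sum_(S : {set 'I_m}) #|V|.-1.
  by rewrite sum_nat_const -[#|{set _}|]cardsT -powersetT card_powerset cardsT card_ord.
rewrite -sum1_card (partition_big D predT) //= big_distrl /=.
apply: leq_sum => S _; have := none S; case: (leqP s #|S|) => sS /= H; last first.
  rewrite big1 // => v /andP[]; rewrite inE => svD /eqP DS.
  by move: svD; rewrite DS leqNgt sS.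
have le_S : \sum_(v in B | D v == S) 1 <= #|\bigcap_(j in S) F j|.
  rewrite sum1_card; apply/subset_leq_card/subsetP => v.
  rewrite unfold_in => /andP[_ /eqP DS]; apply/bigcapP => j; by rewrite -DS inE.
rewrite -ltnS prednK //; apply: leq_ltn_trans (leq_mul le_S (leqnn _)) _.
by rewrite ltnNge.
Qed.

Section TupleSums.
Variable V : finType.

(** The sum of [f] over all sequences of length [k]. New entries are prepended
    and summed innermost, so that bounding the number of extensions of a
    sequence is a pointwise bound under the outer sums. *)
Fixpoint tuple_sum k (f : seq V -> nat) : nat :=
  if k is k'.+1 then tuple_sum k' (fun t => \sum_v f (v :: t)) else f [::].

Lemma leq_tuple_sum k f g : (forall t, f t <= g t) -> tuple_sum k f <= tuple_sum k g.
Proof.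
elim: k f g => [|k IHk] f g le_fg /=; first exact: le_fg.
by apply: IHk => t; apply: leq_sum => v _; apply: le_fg.
Qed.

Lemma tuple_sum_affine k a b f :
  tuple_sum k (fun t => a * f t + b) = a * tuple_sum k f + b * #|V| ^ k.
Proof.
elim: k f b => [|k IHk] f b /=; first by rewrite muln1.
rewrite expnS mulnA -(IHk (fun t => \sum_v f (v :: t))).
have E t : \sum_v (a * f (v :: t) + b) = a * (\sum_v f (v :: t)) + b * #|V|.
  by rewrite big_split /= -big_distrr /= sum_nat_const mulnC [b * _]mulnC mulnC.
by apply/eqP; rewrite eqn_leq; apply/andP; split; apply: leq_tuple_sum => t; rewrite E.
Qed.

End TupleSums.

(** A dense family of [k.+1]-tuples contains a blow-up: the [j]-th entries of the
    rows [R] form part [j] of size [s], and [T] is the last part. The rows are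
    kept as members of the family, because the induction extends whole rows: a
    row of length [k.+1] is an old row with its own vertex of the old [T]
    prepended. Reducing [k] replaces [s] by [q * s], which leaves
    [q ^ k * s] unchanged; a family of 1-tuples loses nothing, hence the factor
    [(0 < k)]. *)
Lemma many_tuples_blowup (V : finType) (e : rel V) k (M : seq V -> bool) q s :
    0 < s -> 0 < q -> irreflexive e -> symmetric e ->
    (forall t, M t -> pairwise e t) ->
    q * 2 ^ (q ^ k * s) * (q ^ k * s) <= #|V| ->
    2 * k.+1 * #|V| ^ k.+1 <= q * tuple_sum k.+1 M ->
  exists (R : 'I_s -> seq V) (T : {set V}),
    [/\ forall j, size (R j) = k,
        forall j v, v \in T -> M (v :: R j),
        forall x0 j j' i i', i < k -> i' < k -> i != i' ->
          e (nth x0 (R j) i) (nth x0 (R j') i'),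
        forall x0 i, i < k -> injective (fun j => nth x0 (R j) i)
      & #|V| <= #|T| * (q * 2 ^ (q * s * (0 < k)))].
Proof.
move=> s_gt0 q_gt0 e_irr e_sym.
elim: k M s s_gt0 => [|k IHk] M s s_gt0 M_clique V_large M_large.
  exists (fun=> [::]), [set v | M [:: v]]; split=> //.
    by move=> _ v; rewrite inE.
  rewrite muln0 muln1; move: M_large => /=; rewrite muln1 expn1 mulnC.
  have -> : \sum_v M [:: v] = #|[set v | M [:: v]]|.
    rewrite -sum1_card [RHS]big_mkcond; apply: eq_bigr => v _; rewrite inE.
    by case: (M _).
  lia.
have V_gt0 : 0 < #|V|.
  apply: leq_trans V_large; by rewrite !muln_gt0 !expn_gt0 q_gt0 s_gt0.
pose ext t := [set v | M (v :: t)].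
pose M' t := 2 * #|V| <= q * #|ext t|.
have extE t : \sum_v (M (v :: t) : nat) = #|ext t|.
  rewrite -sum1_card [RHS]big_mkcond; apply: eq_bigr => v _; rewrite inE.
  by case: (M _).
have M'_clique t : M' t -> pairwise e t.
  move=> M't; have /card_gt0P[v] : 0 < #|ext t|.
    by move: M't; rewrite /M'; case: #|ext t| => //; lia.
  by rewrite inE => /M_clique /= /andP[].
(* A tuple outside [M'] has at most [2 * #|V| / q] extensions, so projecting
   to [M'] loses one of the [k.+2] units of density. *)
have M'_large : 2 * k.+1 * #|V| ^ k.+1 <= q * tuple_sum k.+1 M'.
  rewrite -(leq_pmul2l V_gt0) -(leq_add2r (2 * #|V| * #|V| ^ k.+1)).
  have -> : #|V| * (2 * k.+1 * #|V| ^ k.+1) + 2 * #|V| * #|V| ^ k.+1 =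
            2 * k.+2 * #|V| ^ k.+2 by rewrite !expnS; lia.
  apply: leq_trans M_large _.
  rewrite mulnA [#|V| * q]mulnC -tuple_sum_affine.
  have -> : q * tuple_sum k.+2 M = tuple_sum k.+1 (fun t => q * (\sum_v M (v :: t)) + 0).
    by rewrite tuple_sum_affine addn0.
  apply: leq_tuple_sum => t; rewrite addn0 extE /M'.
  case: (leqP (2 * _) (q * _)) => [_|/ltnW]; last by rewrite muln0.
  rewrite muln1; apply: leq_trans (leq_addr _ _); by rewrite leq_mul2l max_card orbT.
have qE : q ^ k * (q * s) = q ^ k.+1 * s by rewrite expnS; lia.
have qs_gt0 : 0 < q * s by rewrite muln_gt0 q_gt0.
have [|R [T [szR TM adjR injR T_large]]] := IHk M' _ qs_gt0 M'_clique _ M'_large.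
  by rewrite qE.
(* [T] supplies a distinct new vertex for each of the [q * s] rows. *)
have le_T : q * s <= #|T|.
  rewrite leqNgt; apply/negP => lt_T; move: V_large; rewrite leqNgt => /negP; apply.
  apply: leq_ltn_trans T_large _; rewrite mulnC.
  apply: (@leq_ltn_trans (q * 2 ^ (q ^ k.+1 * s) * #|T|)).
    rewrite leq_mul2r leq_mul2l leq_exp2l //; apply/orP; right; apply/orP; right.
    case: (k) => [|k']; rewrite ?muln0 // muln1 mulnA leq_mul2r !expnS mulnA.
    by rewrite leq_pmulr ?expn_gt0 ?q_gt0 // orbT.
  rewrite ltn_pmul2l ?muln_gt0 ?expn_gt0 ?q_gt0 //.
  by apply: leq_trans lt_T _; rewrite -qE leq_pmull // expn_gt0 q_gt0.
pose w (j : 'I_(q * s)) := enum_val (widen_ord le_T j).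
have wT j : w j \in T by apply: enum_valP.
have w_inj : injective w by move=> j j' /enum_val_inj[] /val_inj.
have R'M j : M' (w j :: R j) by apply: TM.
have [S [sS S_large]] := popular_intersection qs_gt0 erefl R'M.
pose h (j : 'I_s) := enum_val (widen_ord sS j).
have hS j : h j \in S by apply: enum_valP.
have h_inj : injective h by move=> j j' /enum_val_inj[] /val_inj.
have adj_wR x0 j j' i : i < k -> e (w j) (nth x0 (R j') i).
  move=> lt_ik; have /= /andP[/allP wR _] := M'_clique _ (TM j' _ (wT j)).
  by apply: wR; rewrite mem_nth ?szR.
exists (fun j => w (h j) :: R (h j)), (\bigcap_(j in S) ext (w j :: R j)); split.
- by move=> j /=; rewrite szR.
- by move=> j v /bigcapP/(_ _ (hS j)); rewrite inE.
- move=> x0 j j' [|i] [|i'] //= lti lti' ii'; first exact: adj_wR.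
    by rewrite e_sym adj_wR.
  exact: adjR.
- move=> x0 [|i] /= lti j j' E; apply: h_inj; first exact: w_inj.
  exact: injR E.
- by rewrite muln1.
Qed.

(** A clique is the set of entries of at least one tuple. The weight [g] is there
    for the induction, which removes one vertex of the clique at a time. *)
Lemma sum_cliques_le_tuples (V : finType) (G : sgraph V) s (g : {set V} -> nat) :
  \sum_(K in cliques G s) g K <= tuple_sum s (fun t => pairwise G t * g [set x in t]).
Proof.
elim: s g => [|s IHs] g.
  by rewrite cliques0 big_set1 /= mul1n (_ : [set x in [::]] = set0) //; apply/setP=> x; rewrite !inE.
apply: (@leq_trans (\sum_(K in cliques G s.+1) \sum_(x in K) g (x |: (K :\ x)))).
  apply: leq_sum => K /cliquesP[sK _].
  rewrite (eq_bigr (fun=> g K)) => [|x xK]; last by rewrite setD1K.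
  by rewrite sum_nat_const sK leq_pmull.
rewrite (sum_clique_flags _ _ (fun L x => g (x |: L))).
apply: leq_trans (IHs _) _; apply: leq_tuple_sum => t.
rewrite big_distrr big_mkcond /=; apply: leq_sum => v _.
case: ifP => // /common_nbrsP vt; rewrite set_cons.
case tG: (pairwise G t); rewrite ?mul0n //= andbT.
rewrite (_ : all _ _ = true) //; apply/allP => u ut.
by rewrite adj_sym; apply: vt; rewrite inE.
Qed.

Lemma many_cliques_contain (V : finType) (G : sgraph V) r q s t :
    0 < s -> 0 < q ->
    q * 2 ^ (q ^ r * s) * (q ^ r * s) <= #|V| ->
    t * (q * 2 ^ (q * s)) <= #|V| ->
    2 * r.+1 * #|V| ^ r.+1 <= q * #|cliques G r.+1| ->
  contains G (kpart (part_sizes r s t)).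
Proof.
move=> s_gt0 q_gt0 V_large t_small many.
have [x0 _] : exists x0 : V, x0 \in V.
  by apply/card_gt0P; apply: leq_trans V_large; rewrite !muln_gt0 !expn_gt0 q_gt0 s_gt0.
have many' : 2 * r.+1 * #|V| ^ r.+1 <= q * tuple_sum r.+1 (pairwise G).
  apply: leq_trans many _; rewrite leq_mul2l; apply/orP; right.
  rewrite -sum1_card; apply: leq_trans (sum_cliques_le_tuples _ _ _) _.
  by apply: leq_tuple_sum => u; rewrite muln1.
have [] := many_tuples_blowup s_gt0 q_gt0 (@adj_irr _ G) (@adj_sym _ G) (fun t => id) V_large many'.
move=> R [T [szR TM adjR injR T_large]].
have tT : t <= #|T|.
  have c_gt0 : 0 < q * 2 ^ (q * s) by rewrite muln_gt0 q_gt0 expn_gt0.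
  rewrite -(leq_pmul2r c_gt0); apply: leq_trans t_small (leq_trans T_large _).
  by rewrite !leq_mul // leq_exp2l // -[X in _ <= X]muln1 leq_mul // leq_b1.
case: s s_gt0 {V_large t_small T_large} R szR TM adjR injR => // s _ R szR TM adjR injR.
pose f (u : kpart_vertex (part_sizes r s.+1 t)) : V :=
  if tag u < r then nth x0 (R (inord (tagged u))) (tag u)
  else nth x0 (enum T) (tagged u).
have fT (u : kpart_vertex (part_sizes r s.+1 t)) : ~~ (tag u < r) -> f u \in T.
  move=> ur; rewrite /f (negPf ur) -mem_enum mem_nth // -cardE.
  apply: leq_trans tT; have := ltn_ord (tagged u).
  by rewrite [X in _ < X]/part_sizes (negPf ur).
have adjRT j i v : i < r -> v \in T -> G (nth x0 (R j) i) v.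
  move=> ir vT; have /= /andP[/allP vR _] := TM j _ vT.
  by rewrite adj_sym; apply: vR; rewrite mem_nth ?szR.
have f_adj u v : tag u != tag v -> G (f u) (f v).
  move=> uv; have [ur|ur] := boolP (tag u < r); have [vr|vr] := boolP (tag v < r).
  - by rewrite /f ur vr; apply: adjR.
  - by rewrite {1}/f ur; apply/adjRT/fT.
  - by rewrite adj_sym {1}/f vr; apply/adjRT/fT.
  case/eqP: uv; apply: ord_inj.
  have := ltn_ord (tag u); have := ltn_ord (tag v); rewrite !ltnS => rv ru.
  by apply: etrans (_ : r = _); apply/eqP; rewrite eqn_leq ?rv ?ru leqNgt ?ur ?vr.
exists f; split; last by move=> u v; apply: f_adj.
move=> u v fuv; have [|/f_adj] := eqVneq (tag u) (tag v); last by rewrite fuv adj_irr.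
case: u v fuv => i j [i' j'] /= fuv ii'; subst i'; congr (existT _ _ _).
have ltj : j < (if i < r then s.+1 else t) := ltn_ord j.
have ltj' : j' < (if i < r then s.+1 else t) := ltn_ord j'.
apply: val_inj; move: fuv ltj ltj'; rewrite /f /=; case: ifP => ir + ltj ltj'.
  by move/(injR _ _ ir)/(congr1 val); rewrite /= !inordK.
by move/eqP; rewrite nth_uniq ?enum_uniq -?cardE ?(leq_trans _ tT) // => /eqP.
Qed.

(** * Edges, complete multipartite graphs and Turan graphs *)

Section Edges.
Variables (V : finType).
Implicit Types (G H : sgraph V).

Lemma eq_set2 (x y u v : V) : x != y ->
  ([set u; v] == [set x; y]) = ((u, v) == (x, y)) || ((u, v) == (y, x)).
Proof.
rewrite !xpair_eqE eqEsubset !subUset !sub1set !inE.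
rewrite [x == u]eq_sym [x == v]eq_sym [y == u]eq_sym [y == v]eq_sym.
case: (eqVneq u x) => [->|_]; case: (eqVneq v x) => [->|_];
  rewrite ?eqxx /= ?orbF ?andbF ?andbT ?orbT // => xy.
- by rewrite (negPf xy) orbF andbb.
by rewrite (negPf xy) orbF andbb.
Qed.

Lemma adj_neq G x y : G x y -> x != y.
Proof. by apply: contraTneq => ->; rewrite adj_irr. Qed.

Lemma mem_edges G x y : ([set x; y] \in edges G) = G x y.
Proof.
apply/imsetP/idP=> [[[u v]] |Gxy]; last by exists (x, y); rewrite ?inE.
rewrite inE /= => Guv /eqP; rewrite eq_set2 ?(adj_neq Guv) // !xpair_eqE.
by case/orP=> /andP[/eqP-> /eqP->] //; rewrite adj_sym.
Qed.

(** Ordered pairs are easier to bound by pointwise comparison than edges as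
    2-subsets; this lemma and [card_edge_diff] move between the two. *)
Lemma card_edges G : 2 * #|edges G| = #|[set p : V * V | G p.1 p.2]|.
Proof.
pose h (p : V * V) := [set p.1; p.2].
have hE : edges G = h @: [set p : V * V | G p.1 p.2].
  by apply/setP=> e; apply/imsetP/imsetP=> -[p]; rewrite !inE => Gp ->; exists p; rewrite ?inE.
rewrite hE -[RHS]sum1_card (partition_big_imset h) /=.
rewrite mulnC -sum_nat_const; apply: eq_bigr => e /imsetP[[x y]].
rewrite inE /= => Gxy ->; have xy := adj_neq Gxy.
rewrite sum1_card; transitivity #|[set (x, y); (y, x)]|.
  by rewrite cards2 xpair_eqE negb_and xy.
apply: eq_card => -[u v]; rewrite !inE unfold_in /= inE /= eq_set2 //.
rewrite !xpair_eqE; apply/idP/andP=> [H|[]//]; split=> //.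
by case/orP: H => /andP[/eqP-> /eqP->] //; rewrite adj_sym.
Qed.

Lemma card_edge_diff G H :
  2 * edge_diff G H = #|[set p : V * V | G p.1 p.2 != H p.1 p.2]|.
Proof.
have D_sym : symmetric (fun x y => G x y != H x y).
  by move=> x y; rewrite adj_sym [H x y]adj_sym.
have D_irr : irreflexive (fun x y => G x y != H x y).
  by move=> x; rewrite !adj_irr.
rewrite -(card_edges (SGraph D_sym D_irr)) /edge_diff; congr (2 * _).
have pairE F e : e \in edges F -> exists x y : V, e = [set x; y].
  by move=> /imsetP[[x y] _ ->]; exists x, y.
apply: eq_card => e; rewrite !inE.
have E x y : ([set x; y] \notin edges H) && ([set x; y] \in edges G)
    || ([set x; y] \notin edges G) && ([set x; y] \in edges H)
    = ([set x; y] \in edges (SGraph D_sym D_irr)).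
  by rewrite !mem_edges /=; case: (G x y); case: (H x y).
apply/idP/idP=> [He|/[dup] /pairE[x [y ->]]]; last by rewrite E.
have [x [y exy]] : exists x y : V, e = [set x; y].
  by case/orP: He => /andP[_]; apply: pairE.
by rewrite exy -E -exy.
Qed.

End Edges.

Section Multipartite.
Variables (V : finType) (r : nat).
Implicit Types (P : V -> 'I_r).

Lemma label_graph_sym P : symmetric (fun u v => P u != P v).
Proof. by move=> u v; rewrite eq_sym. Qed.
Lemma label_graph_irr P : irreflexive (fun u v => P u != P v).
Proof. by move=> u; rewrite eqxx. Qed.
Definition label_graph P : sgraph V := SGraph (label_graph_sym P) (label_graph_irr P).

Definition part P i : {set V} := [set v | P v == i].

Lemma sum_part P : \sum_i #|part P i| = #|V|.
Proof.
rewrite -sum1_card (partition_big P predT) //=.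
by apply: eq_bigr => i _; rewrite sum1_card; apply: eq_card => v; rewrite inE.
Qed.

Lemma card_label_graph P :
  #|[set p : V * V | label_graph P p.1 p.2]| + \sum_i #|part P i| ^ 2 = #|V| ^ 2.
Proof.
have -> : \sum_i #|part P i| ^ 2 = #|[set p : V * V | P p.1 == P p.2]|.
  rewrite -[RHS]sum1_card (partition_big (fun p => P p.1) predT) //=.
  apply: eq_bigr => i _; rewrite expnS expn1 -cardsX sum1_card.
  apply: eq_card => -[u v]; rewrite !inE /= unfold_in /= inE /=.
  by case: (eqVneq (P u) i) => [<-|_]; rewrite /= ?andbF // andbT eq_sym.
rewrite -[_ ^ 2]mulnn -card_prod -(cardC [set p : V * V | P p.1 == P p.2]) addnC; congr (_ + _).
by apply: eq_card => p; rewrite !inE.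
Qed.

Lemma label_graph_kpart P (s : 'I_r -> nat) :
  (forall i, #|part P i| = s i) -> isomorphic (label_graph P) (kpart s).
Proof.
move=> sP; pose f (u : kpart_vertex s) := enum_val (cast_ord (esym (sP (tag u))) (tagged u)).
have Pf u : P (f u) = tag u.
  by have := enum_valP (cast_ord (esym (sP (tag u))) (tagged u)); rewrite inE => /eqP.
exists f; split; last by move=> u v; rewrite /= !Pf.
apply: inj_card_bij.
  move=> u v fuv; have := Pf u; rewrite fuv Pf.
  case: u v fuv => i j [i' j'] /= + ii'; subst i' => /enum_val_inj/cast_ord_inj /= e.
  by congr (existT _ _ _).
rewrite -(sum_part P) -sum1_card (partition_big (@tag _ _) predT) //=; apply: leq_sum => i _.
rewrite sP sum1_card -[X in X <= _]card_ord.
have inj : injective (fun j : 'I_(s i) => existT (fun i => 'I_(s i)) i j : kpart_vertex s).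
  by move=> j j' /eqP; rewrite -tag_eqE /tag_eq /= eqxx tagged_asE => /eqP.
rewrite -(card_imset _ inj); apply/subset_leq_card/subsetP => u /imsetP[j _ ->].
exact: eqxx.
Qed.

(** Repeatedly move one vertex from a part that is too large to one that is too
    small; each move lowers the total excess by one. *)
Lemma relabel_sizes P (s : 'I_r -> nat) : \sum_i s i = #|V| ->
  exists P' : V -> 'I_r, (forall i, #|part P' i| = s i) /\
    #|[set v | P v != P' v]| <= \sum_i (#|part P i| - s i).
Proof.
move=> sum_s.
have [m] := ubnP (\sum_i (#|part P i| - s i)); elim: m P => // m IHm P lt_m.
have [/existsP[i lt_i]|none] := boolP [exists i, s i < #|part P i|]; last first.
  have le_s i : #|part P i| <= s i.
    by move: none; rewrite negb_exists => /forallP/(_ i); rewrite -leqNgt.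
  exists P; split; last by rewrite (_ : [set v | _] = set0) ?cards0 //; apply/setP=> v; rewrite !inE eqxx.
  have := leqif_sum (fun i (_ : true) => leqif_eq (le_s i)).
  by rewrite sum_part sum_s => /leqif_refl/forallP Es i; apply/eqP/(implyP (Es i)).
have [j lt_j] : exists j, #|part P j| < s j.
  apply/existsP; apply: contraT; rewrite negb_exists => /forallP ge_s.
  have : \sum_i s i < \sum_i #|part P i|.
    rewrite (bigD1 i) //= [X in _ < X](bigD1 i) //= -addSn leq_add // leq_sum // => k _.
    by rewrite leqNgt ge_s.
  by rewrite sum_s sum_part ltnn.
have [v] : exists v, v \in part P i by apply/card_gt0P; apply: leq_ltn_trans lt_i.
rewrite inE => /eqP Pv.
have ij : i != j by apply: contraTneq lt_j => <-; rewrite -leqNgt ltnW.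
pose P1 u := if u == v then j else P u.
have p1i : #|part P i| = (#|part P1 i|).+1.
  rewrite (cardsD1 v) inE Pv eqxx; congr (_.+1); apply: eq_card => u.
  by rewrite !inE /P1; case: (u =P v) => //= _; rewrite eq_sym (negPf ij).
have p1j : #|part P1 j| = (#|part P j|).+1.
  rewrite (cardsD1 v) inE /P1 !eqxx; congr (_.+1); apply: eq_card => u.
  by rewrite !inE; case: (u =P v) => //= ->; rewrite Pv (negPf ij).
have p1k k : k != i -> k != j -> #|part P1 k| = #|part P k|.
  move=> ki kj; apply: eq_card => u; rewrite !inE /P1; case: (u =P v) => // ->.
  by rewrite Pv eq_sym (negPf kj) eq_sym (negPf ki).
have lt_sum : \sum_i (#|part P1 i| - s i) < \sum_i (#|part P i| - s i).
  rewrite (bigD1 i) //= [X in _ < X](bigD1 i) //= -addSn leq_add //.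
    by rewrite p1i subSn // -ltnS -p1i.
  apply: leq_sum => k ki; have [->|kj] := eqVneq k j; last by rewrite p1k.
  by rewrite p1j; move: lt_j; rewrite -subn_eq0 => /eqP ->.
have [P' [sP' moved]] := IHm P1 (leq_trans lt_sum lt_m).
exists P'; split=> //; apply: leq_trans lt_sum.
apply: leq_trans (_ : #|v |: [set u | P1 u != P' u]| <= _).
  apply/subset_leq_card/subsetP => u; rewrite !inE /P1; case: (u =P v) => //.
by apply: leq_trans (leq_of_leqif (leq_card_setU _ _)) _; rewrite cards1 add1n ltnS.
Qed.

Definition inner_pairs (G : sgraph V) P :=
  [set p : V * V | G p.1 p.2 && (P p.1 == P p.2)].

Lemma card_setE (T : finType) (a : pred T) : #|[set x | a x]| = \sum_x a x.
Proof.
by rewrite -sum1dep_card big_mkcond; apply: eq_bigr => x _; case: (a x).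
Qed.

Lemma edges_le_label_graph (G : sgraph V) P :
  2 * #|edges G| + \sum_i #|part P i| ^ 2 <= #|V| ^ 2 + #|inner_pairs G P|.
Proof.
rewrite -(card_label_graph P) [X in _ <= X]addnAC leq_add2r card_edges.
rewrite !card_setE -big_split; apply: leq_sum => p _ /=.
by case: (G _ _); case: (_ == _).
Qed.

Definition turan_size n (i : 'I_r) : nat := n %/ r + (i < n %% r).

Lemma sum_turan_size n : 0 < r -> \sum_i turan_size n i = n.
Proof.
move=> r_gt0; rewrite big_split /= sum_nat_const card_ord.
rewrite [in RHS](divn_eq n r) mulnC; congr (_ + _).
have := ltnW (ltn_pmod n r_gt0); move: (n %% r) => m le_mr.
rewrite -[RHS](card_ord m) -sum1_card (big_ord_widen r (fun=> 1)) // [RHS]big_mkcond.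
by apply: eq_bigr => i _; case: ltnP.
Qed.

(** Compare [G] with the complete multipartite graph [H] of [P], then [H] with
    the one obtained after balancing the parts. An edge of [H] missing in [G] is
    counted through the number of edges: [#|H \ G| = #|H| - #|G| + #|G \ H|].
    Every moved vertex changes at most [#|V|] pairs in each order. *)
Lemma turan_close (G : sgraph V) P : 0 < r ->
  exists T : sgraph V, is_turan r #|V| T /\
    2 * edge_diff G T + 2 * #|edges G| + \sum_i #|part P i| ^ 2 <=
    #|V| ^ 2 + 2 * #|inner_pairs G P| +
      2 * (\sum_i (#|part P i| - turan_size #|V| i) * #|V|).
Proof.
move=> r_gt0.
have [P' [sP' moved]] := relabel_sizes P (sum_turan_size #|V| r_gt0).
exists (label_graph P'); split.
  exists (turan_size #|V|); split; [exact: sum_turan_size| |exact: label_graph_kpart].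
  by move=> i j; rewrite /turan_size; lia.
set M := [set v | _] in moved.
have HT : #|[set p : V * V | label_graph P p.1 p.2 != label_graph P' p.1 p.2]| <=
    2 * (\sum_i (#|part P i| - turan_size #|V| i) * #|V|).
  rewrite -big_distrl /=; apply: leq_trans (leq_mul (leqnn 2) (leq_mul moved (leqnn _))).
  apply: (@leq_trans #|setX M setT :|: setX setT M|).
    apply/subset_leq_card/subsetP => -[u v]; rewrite !inE /= andbT.
    by apply: contraNT; rewrite negb_or !negbK => /andP[/eqP-> /eqP->].
  apply: leq_trans (leq_of_leqif (leq_card_setU _ _)) _.
  by rewrite !cardsX cardsT mul2n -addnn leq_add2l mulnC.
rewrite card_edge_diff card_edges -(card_label_graph P).
rewrite -[X in _ <= X]addnA [X in _ <= X]addnAC leq_add2r.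
apply: leq_trans (leq_add (leqnn _) (leq_add (leqnn _) HT)).
rewrite !card_setE mul2n -addnn -!big_split; apply: leq_sum => p _ /=.
by case: (G _ _); case: (P _ == _); case: (P' _ == _).
Qed.

End Multipartite.

(** * The partition given by a clique *)

Section GoodPartition.
Variables (V : finType) (G : sgraph V).

(** The part of a vertex is the position in [enum K] of the vertex of [K] that it
    misses. Vertices outside [near_nbrs K] are few and go to part 0. *)
Definition clique_label s (K : {set V}) (v : V) : 'I_s.+1 :=
  odflt ord0 [pick i : 'I_s.+1 |
    v \in common_nbrs G (K :\ nth v (enum K) i) :\: common_nbrs G K].

Lemma clique_labelP s K v : K \in cliques G s.+1 -> v \in near_nbrs G K ->
  v \in common_nbrs G (K :\ nth v (enum K) (clique_label s K v)).
Proof.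
move=> /cliquesP[sK _] /setDP[/bigcupP[x xK vKx] vK].
rewrite /clique_label; case: pickP => [i /setDP[]|] //=.
have ltx : index x (enum K) < s.+1 by rewrite -sK cardE index_mem mem_enum.
move/(_ (Ordinal ltx)); rewrite /= nth_index ?mem_enum //.
by rewrite inE vK vKx.
Qed.

Lemma leq_card_bigcup (I T : finType) (A : {pred I}) (F : I -> {set T}) :
  #|\bigcup_(i in A) F i| <= \sum_(i in A) #|F i|.
Proof.
elim/big_rec2: _ => [|i m U _ le_U]; first by rewrite cards0.
by apply: leq_trans (leq_of_leqif (leq_card_setU _ _)) _; rewrite leq_add2l.
Qed.

Definition adj_pairs (A : {set V}) :=
  [set p : V * V | [&& G p.1 p.2, p.1 \in A & p.2 \in A]].

Lemma card_inner_pairs_clique s K : K \in cliques G s.+1 ->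
  #|inner_pairs G (clique_label s K)| + 2 * #|V| * #|near_nbrs G K| <=
  2 * #|V| ^ 2 + \sum_(x in K) #|adj_pairs (common_nbrs G (K :\ x))|.
Proof.
move=> cK; set B := near_nbrs G K.
have sub : inner_pairs G (clique_label s K) \subset
    (setX (~: B) setT :|: setX setT (~: B)) :|:
    \bigcup_(x in K) adj_pairs (common_nbrs G (K :\ x)).
  apply/subsetP => -[u v]; rewrite inE => /andP[/= Guv /eqP Puv].
  rewrite 2!in_setU !in_setX !in_setC !in_setT /= andbT.
  have [uB|//] := boolP (u \in B); have [vB|//] := boolP (v \in B); rewrite /=.
  apply/bigcupP; exists (nth u (enum K) (clique_label s K u)).
    by rewrite -mem_enum mem_nth // -cardE; case/cliquesP: cK => ->.
  rewrite inE /= Guv clique_labelP //= Puv.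
  rewrite (set_nth_default v) ?clique_labelP //.
  by rewrite -cardE; case/cliquesP: cK => ->.
have := leq_trans (subset_leq_card sub) (leq_of_leqif (leq_card_setU _ _)).
move/leq_trans/(_ (leq_add (leq_of_leqif (leq_card_setU _ _)) (leq_card_bigcup _ _))).
rewrite !cardsX cardsT -[#|V| * #|~: B|]mulnC => le_X.
apply: leq_trans (leq_add le_X (leqnn _)) _.
rewrite addnAC leq_add2r -(cardsC B); nia.
Qed.

(** The partition of a best [r]-clique. Inner pairs either meet the complement of
    [near_nbrs K], whose size is controlled through [sum_sqr_common_nbrs], or
    lie inside the common neighbourhood of some [K :\ x], where
    [sum_edges_in_common_nbrs] bounds them by cliques of size [s.+2]. *)
Lemma good_partition s : 0 < #|cliques G s.+1| ->
  exists P : V -> 'I_s.+1,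
    #|cliques G s.+1| * #|inner_pairs G P|
      + 2 * #|V| * (\sum_(L in cliques G s) #|common_nbrs G L| ^ 2) <=
    2 * #|V| ^ 2 * #|cliques G s.+1| + 3 * #|V| * (s.+1 * (s.+2 * #|cliques G s.+2|)).
Proof.
move=> k_gt0; pose X K := #|inner_pairs G (clique_label s K)|.
have sum_X : \sum_(K in cliques G s.+1) X K
    + 2 * #|V| * (\sum_(L in cliques G s) #|common_nbrs G L| ^ 2) <=
    2 * #|V| ^ 2 * #|cliques G s.+1| + 3 * #|V| * (s.+1 * (s.+2 * #|cliques G s.+2|)).
  have le_X : \sum_(K in cliques G s.+1) X K
      + 2 * #|V| * (\sum_(K in cliques G s.+1) #|near_nbrs G K|) <=
      2 * #|V| ^ 2 * #|cliques G s.+1| + #|V| * (s.+1 * (s.+2 * #|cliques G s.+2|)).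
    rewrite big_distrr -big_split /=.
    apply: (@leq_trans (\sum_(K in cliques G s.+1)
        (2 * #|V| ^ 2 + \sum_(x in K) #|adj_pairs (common_nbrs G (K :\ x))|))).
      by apply: leq_sum => K; apply: card_inner_pairs_clique.
    rewrite big_split /= sum_nat_const [#|_| * _]mulnC leq_add2l.
    rewrite (sum_clique_flags _ s (fun L _ => #|adj_pairs (common_nbrs G L)|)).
    rewrite -(sum_edges_in_common_nbrs G s) big_distrr /=; apply: leq_sum => L _.
    by rewrite sum_nat_const leq_mul2r max_card orbT.
  rewrite sum_sqr_common_nbrs mulnDr addnA.
  apply: leq_trans (leq_add le_X (leqnn _)) _.
  by rewrite -addnA leq_add2l -[2 * #|V| * _]mulnA -[3 * _ * _]mulnA -mulSn.
have /exists_inP[K cK le_K] : [exists K in cliques G s.+1,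
    #|cliques G s.+1| * X K <= \sum_(K in cliques G s.+1) X K].
  apply: contraT; rewrite negb_exists_in => /forall_inP gt_X.
  have : \sum_(K in cliques G s.+1) (\sum_(K in cliques G s.+1) X K).+1 <=
         \sum_(K in cliques G s.+1) #|cliques G s.+1| * X K.
    by apply: leq_sum => K cK; rewrite ltnNge gt_X.
  by rewrite sum_nat_const -big_distrr leq_pmul2l // ltnn.
exists (clique_label s K); apply: leq_trans sum_X; by rewrite leq_add2r.
Qed.

End GoodPartition.

Local Open Scope ring_scope.

(** * Stability from clique densities *)

Lemma sqr_sum_le (R : realDomainType) (I : finType) (A : {pred I}) (f : I -> R) :
  (\sum_(i in A) f i) ^+ 2 <= #|A|%:R * \sum_(i in A) f i ^+ 2.
Proof.
have : 0 <= \sum_(i in A) \sum_(j in A) (f i - f j) ^+ 2.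
  by apply: sumr_ge0 => i _; apply: sumr_ge0 => j _; apply: sqr_ge0.
have -> : \sum_(i in A) \sum_(j in A) (f i - f j) ^+ 2 =
    2 * (#|A|%:R * (\sum_(i in A) f i ^+ 2) - (\sum_(i in A) f i) ^+ 2).
  under eq_bigr => i _.
    under eq_bigr => j _ do rewrite sqrrB.
    rewrite big_split /= sumrB sumr_const sumrMnl -mulr_sumr.
    over.
  rewrite big_split /= sumrB sumr_const !sumrMnl -mulr_suml.
  ring.
by rewrite pmulr_rge0 // subr_ge0.
Qed.

Section Stability.
Variables (R : realFieldType) (V : finType) (G : sgraph V).
Local Notation n := (#|V|%:R : R).
Local Notation k s := (#|cliques G s|%:R : R).

Lemma card_cliques2 : #|cliques G 2| = #|edges G|.
Proof.
apply/eqP; rewrite -(eqn_pmul2l (isT : (0 < 2)%N)) card_edges.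
have := sum_edges_in_common_nbrs G 0; rewrite mul1n => <-.
rewrite cliques0 big_set1; apply/eqP/eq_card => p.
by rewrite common_nbrs0 !inE !andbT.
Qed.

Lemma sqr_cliques_le s :
  (s.+1%:R * k s.+1) ^+ 2 <=
  k s * (\sum_(L in cliques G s) #|common_nbrs G L| ^ 2)%N%:R.
Proof.
rewrite -natrM -sum_card_common_nbrs !natr_sum.
by under [in X in _ <= X]eq_bigr do rewrite natrX; apply: sqr_sum_le.
Qed.

(** With [y_s = 1 - s a], Cauchy-Schwarz and Moon-Moser give
    [s.+1 * y_s - 1 <= s * (s.+2 * k_(s+2)) / (n k_(s+1))], and the left-hand side
    is [s * y_(s+1)]: the linear bound reproduces itself exactly. *)
Lemma cliques_growth (a : R) s : 0 < a -> s%:R * a < 1 -> (0 < #|V|)%N ->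
    (1 - a) * n ^+ 2 <= 2 * #|edges G|%:R ->
  0 < k s /\ n * (1 - s%:R * a) * k s <= s.+1%:R * k s.+1.
Proof.
move=> a_gt0 + V_gt0 many_edges; have n_gt0 : 0 < n by rewrite ltr0n.
have k0 : k 0 = 1 by rewrite cliques0 cards1.
elim: s => [|s IHs] sa1.
  by rewrite k0 card_cliques1 mul0r subr0 !mulr1 mul1r ltr01 lexx.
have {IHs} [k_gt0 IHs] : 0 < k s /\ n * (1 - s%:R * a) * k s <= s.+1%:R * k s.+1.
  by apply: IHs; apply: le_lt_trans sa1; rewrite ler_wpM2r ?ler_nat ?ltW.
have sa1' : s%:R * a < 1 by apply: le_lt_trans sa1; rewrite ler_wpM2r ?ler_nat ?ltW.
have k1_gt0 : 0 < k s.+1.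
  rewrite -(pmulr_rgt0 _ (ltr0Sn R s)); apply: lt_le_trans IHs.
  by rewrite !mulr_gt0 // subr_gt0.
split=> //; have [s0|s_gt0] := posnP s.
  move: many_edges; rewrite s0 card_cliques1 card_cliques2 mul1r; apply: le_trans.
  by rewrite le_eqVlt; apply/orP; left; apply/eqP; ring.
have MM : (\sum_(L in cliques G s) #|common_nbrs G L| ^ 2)%N%:R <=
    n * k s.+1 + s%:R * (s.+2%:R * k s.+2).
  by rewrite -!natrM -natrD ler_nat; apply: moon_moser.
have CS := le_trans (sqr_cliques_le s) (ler_wpM2l (ltW k_gt0) MM).
have sR_gt0 : 0 < s%:R :> R by rewrite ltr0n.
have sk_gt0 : 0 < s.+1%:R * k s.+1 by rewrite mulr_gt0.
have := le_trans (ler_wpM2r (ltW sk_gt0) IHs) CS.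
rewrite [X in X <= _](_ : _ = k s * (n * (1 - s%:R * a) * (s.+1%:R * k s.+1))); last by ring.
rewrite ler_pM2l // => ineq.
rewrite -(ler_pM2l sR_gt0) -subr_ge0; move: ineq; rewrite -subr_ge0.
rewrite -!natr1 => /le_trans; apply; rewrite le_eqVlt; apply/orP; left; apply/eqP.
ring.
Qed.

(** The factor [1 - r ^ 2 eps] at each step is loose but makes the product
    telescope into a binomial coefficient. For [s = r] the main term is
    [(n / r) ^ r], the clique count of the balanced [r]-partite graph. *)
Lemma cliques_lower (r : nat) (eps : R) s : (0 < r)%N -> (0 < #|V|)%N ->
    0 < eps -> r%:R ^+ 2 * eps <= 1 ->
    (1 - 1 / r%:R - eps) * n ^+ 2 <= 2 * #|edges G|%:R -> (s <= r)%N ->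
  'C(r, s)%:R * (n / r%:R) ^+ s * (1 - r%:R ^+ 2 * eps) ^+ s <= k s.
Proof.
move=> r_gt0 V_gt0 eps_gt0 eta_le1 many_edges.
have rR_gt0 : 0 < r%:R :> R by rewrite ltr0n.
have n_gt0 : 0 < n by rewrite ltr0n.
set eta := r%:R ^+ 2 * eps in eta_le1 *.
have eta_ge0 : 0 <= 1 - eta by rewrite subr_ge0.
have a_gt0 : 0 < 1 / r%:R + eps by rewrite addr_gt0 // divr_gt0.
elim: s => [|s IHs] lt_sr.
  by rewrite bin0 !expr0 !mulr1 cliques0 cards1.
have {}IHs := IHs (ltnW lt_sr).
have sr1 : s%:R + 1 <= r%:R :> R by rewrite natr1 ler_nat.
(* After clearing eps this is [s <= (r - s) * r], where [s < r] is needed. *)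
have y_ge : (r%:R - s%:R) / r%:R * (1 - eta) <= 1 - s%:R * (1 / r%:R + eps).
  rewrite -subr_ge0 [X in 0 <= X](_ : _ = ((r%:R - s%:R) * r%:R - s%:R) * eps); last first.
    rewrite /eta; field; lra.
  apply: mulr_ge0 (ltW eps_gt0); rewrite subr_ge0.
  apply: le_trans (_ : r%:R <= _); first by lra.
  by apply: ler_peMl; lra.
have [eta1|eta_neq1] := eqVneq eta 1; first by rewrite eta1 subrr expr0n mulr0 ler0n.
have eta_lt1 : 0 < 1 - eta by rewrite lt_def eta_ge0 subr_eq0 eq_sym eta_neq1.
have sa1 : s%:R * (1 / r%:R + eps) < 1.
  rewrite -subr_gt0; apply: lt_le_trans y_ge; rewrite !mulr_gt0 ?invr_gt0 //; lra.
have many_edges' : (1 - (1 / r%:R + eps)) * n ^+ 2 <= 2 * #|edges G|%:R.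
  by rewrite opprD addrA.
have [k_gt0 growth] := cliques_growth a_gt0 sa1 V_gt0 many_edges'.
have s1_gt0 : 0 < s.+1%:R :> R by rewrite ltr0n.
rewrite -(ler_pM2l s1_gt0); apply: le_trans growth.
have binE : s.+1%:R * 'C(r, s.+1)%:R = (r%:R - s%:R) * 'C(r, s)%:R :> R.
  by rewrite -natrB ?(ltnW lt_sr) // -!natrM mul_bin_left.
rewrite mulrA mulrA binE.
apply: le_trans (ler_wpM2l _ IHs); last first.
  by rewrite mulr_ge0 ?(ltW n_gt0) // subr_ge0 ltW.
rewrite [X in X <= _](_ : _ = (n * ((r%:R - s%:R) / r%:R * (1 - eta))) *
   ('C(r, s)%:R * (n / r%:R) ^+ s * (1 - eta) ^+ s)); last first.
  by rewrite !exprS; field; lra.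
apply: ler_wpM2r; last by rewrite ler_wpM2l // ltW.
by rewrite !mulr_ge0 ?exprn_ge0 ?divr_ge0 ?(ltW n_gt0) ?(ltW rR_gt0).
Qed.

Lemma bernoulli (x : R) m : 0 <= x <= 1 -> 1 - m%:R * x <= (1 - x) ^+ m.
Proof.
case/andP=> x_ge0 x_le1; elim: m => [|m IHm]; first by rewrite mul0r subr0 expr0.
have : 0 <= m%:R * x * x by rewrite !mulr_ge0.
have := ler_wpM2l (_ : 0 <= 1 - x) IHm; rewrite subr_ge0 => /(_ x_le1).
rewrite exprS -natr1; lra.
Qed.

(** By [cliques_growth], the sum of the squares in [good_partition] is at least
    [n * k_r] up to a relative error of order [eps]; this cancels the main term
    and leaves only errors proportional to [eps] and [kappa]. *)
Lemma near_partition s (eps kappa : R) (r := s.+1) : (0 < #|V|)%N ->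
    0 < eps -> 0 <= kappa -> r%:R ^+ 3 * eps <= 1 / 2 ->
    (1 - 1 / r%:R - eps) * n ^+ 2 <= 2 * #|edges G|%:R ->
    k r.+1 <= kappa * n ^+ r.+1 ->
  exists P : V -> 'I_r, #|inner_pairs G P|%:R <=
    (2 * r%:R ^+ 2 * eps + 6 * r%:R ^+ r.+1 * r.+1%:R * kappa) * n ^+ 2.
Proof.
move=> V_gt0 eps_gt0 kappa_ge0 eps_small many_edges few.
have r_gt0 : (0 < r)%N by [].
have r_ge1 : 1 <= r%:R :> R by rewrite ler1n.
have rR_gt0 : 0 < r%:R :> R by rewrite ltr0n.
have n_gt0 : 0 < n by rewrite ltr0n.
have eta_small : r%:R * (r%:R ^+ 2 * eps) <= 1 / 2 by rewrite mulrA -exprS.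
have eta_ge0 : 0 <= r%:R ^+ 2 * eps by rewrite mulr_ge0 ?exprn_ge0 ?ltW.
have eta_le1 : r%:R ^+ 2 * eps <= 1.
  by have := ler_wpM2r eta_ge0 r_ge1; rewrite mul1r; lra.
have kr_ge : (n / r%:R) ^+ r / 2 <= k r.
  apply: le_trans (cliques_lower r_gt0 V_gt0 eps_gt0 eta_le1 many_edges (leqnn r)).
  rewrite binn mul1r ler_wpM2l ?exprn_ge0 ?divr_ge0 ?(ltW n_gt0) ?(ltW rR_gt0) //.
  have := @bernoulli (r%:R ^+ 2 * eps) r; rewrite eta_ge0 eta_le1 => /(_ isT).
  apply: le_trans; rewrite (_ : 2^-1 = 1 - 1 / 2 :> R); last by field.
  by rewrite lerD2l lerN2.
have nr_gt0 : 0 < (n / r%:R) ^+ r by rewrite exprn_gt0 ?divr_gt0.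
have kr_gt0 : 0 < k r by apply: lt_le_trans kr_ge; rewrite divr_gt0.
have kr_gt0' : (0 < #|cliques G r|)%N by rewrite -(ltr0n R).
have [P] := good_partition kr_gt0'; rewrite -/r => XP.
exists P; set X := #|inner_pairs G P|%:R.
set D := (\sum_(L in cliques G s) #|common_nbrs G L| ^ 2)%N in XP.
have {}XP : k r * X + 2 * n * D%:R <=
    2 * n ^+ 2 * k r + 3 * n * (r%:R * (r.+1%:R * k r.+1)).
  by rewrite -!natrX -!natrM -!natrD ler_nat.
have a_gt0 : 0 < 1 / r%:R + eps by rewrite addr_gt0 // divr_gt0.
have many_edges' : (1 - (1 / r%:R + eps)) * n ^+ 2 <= 2 * #|edges G|%:R.
  by rewrite opprD addrA.
have rE : s%:R = r%:R - 1 :> R by rewrite /r -natr1 addrK.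
have sa1 : s%:R * (1 / r%:R + eps) < 1.
  rewrite rE -subr_gt0 -(pmulr_rgt0 _ rR_gt0).
  rewrite [X in 0 < X](_ : _ = 1 - (r%:R * r%:R * eps) + r%:R * eps); last by field; lra.
  have : 0 < r%:R * eps by rewrite mulr_gt0.
  move: eta_le1; rewrite expr2; lra.
have [ks_gt0 growth] := cliques_growth a_gt0 sa1 V_gt0 many_edges'.
have D_ge : r%:R * k r * (n * (1 - s%:R * (1 / r%:R + eps))) <= D%:R.
  rewrite -(ler_pM2l ks_gt0); apply: le_trans (sqr_cliques_le s).
  rewrite expr2 [X in X <= _](_ : _ = (r%:R * k r) * (n * (1 - s%:R * (1 / r%:R + eps)) * k s)); last by ring.
  by rewrite ler_wpM2l // mulr_ge0 ?ltW.
have few' : k r.+1 <= 2 * r%:R ^+ r * kappa * n * k r.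
  apply: le_trans few _.
  rewrite [X in X <= _](_ : _ = (2 * r%:R ^+ r * kappa * n) * ((n / r%:R) ^+ r / 2)).
    by rewrite ler_wpM2l // !mulr_ge0 ?exprn_ge0 ?(ltW n_gt0) ?(ltW rR_gt0).
  rewrite expr_div_n exprS; field; rewrite expf_neq0 //; lra.
rewrite -(ler_pM2l kr_gt0).
(* The main terms cancel since [1 - r * (1 - s * (1 / r + eps)) = r * s * eps]
   for [s = r - 1]; the leftover [r * eps] is dropped for a cleaner bound. *)
have le1 : 2 * n * (r%:R * k r * (n * (1 - s%:R * (1 / r%:R + eps)))) <= 2 * n * D%:R.
  by rewrite ler_wpM2l // mulr_ge0 ?ltW.
have le2 : 3 * n * (r%:R * (r.+1%:R * k r.+1)) <=
    3 * n * (r%:R * (r.+1%:R * (2 * r%:R ^+ r * kappa * n * k r))).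
  by rewrite !ler_wpM2l // ?mulr_ge0 ?ltW.
have le3 : 0 <= 2 * n ^+ 2 * k r * (r%:R * eps).
  by rewrite !mulr_ge0 ?exprn_ge0 ?ltW.
apply: le_trans (_ : _ <= 2 * n ^+ 2 * k r +
    3 * n * (r%:R * (r.+1%:R * (2 * r%:R ^+ r * kappa * n * k r))) -
    2 * n * (r%:R * k r * (n * (1 - s%:R * (1 / r%:R + eps))))) _; first by lra.
rewrite -subr_ge0 [X in 0 <= X](_ : _ = 2 * n ^+ 2 * k r * (r%:R * eps)) //.
rewrite rE (exprS _ r); field; lra.
Qed.

(** Since inner pairs are few, [\sum_i p_i ^ 2] is at most [n ^ 2 / r] plus a
    small error, that is, the part sizes have small variance; Cauchy-Schwarz
    bounds their total deviation from [n / r], hence the number of vertices to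
    move, by [delta * n]. The term [r * n] pays for rounding [n / r]. *)
Lemma stability_few_cliques s (eps kappa delta : R) (r := s.+1)
    (xi := 2 * r%:R ^+ 2 * eps + 6 * r%:R ^+ r.+1 * r.+1%:R * kappa) :
    (0 < #|V|)%N -> 0 < eps -> 0 <= kappa -> r%:R ^+ 3 * eps <= 1 / 2 ->
    (1 - 1 / r%:R - eps) * n ^+ 2 <= 2 * #|edges G|%:R ->
    k r.+1 <= kappa * n ^+ r.+1 ->
    0 <= delta -> r%:R * (eps + xi) <= delta ^+ 2 ->
  exists T : sgraph V, is_turan r #|V| T /\
    (edge_diff G T)%:R <= (eps / 2 + xi + delta) * n ^+ 2 + r%:R * n.
Proof.
move=> V_gt0 eps_gt0 kappa_ge0 eps_small many_edges few delta_ge0 delta_large.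
have r_gt0 : (0 < r)%N by [].
have rR_gt0 : 0 < r%:R :> R by rewrite ltr0n.
have n_gt0 : 0 < n by rewrite ltr0n.
have [P XP] := near_partition V_gt0 eps_gt0 kappa_ge0 eps_small many_edges few.
rewrite -/r -/xi in XP; pose p i : R := #|part P i|%:R.
have [T [T_turan diffT]] := turan_close G P r_gt0; exists T; split=> //.
have sum_p : \sum_i p i = n by rewrite -natr_sum sum_part.
have sum_p2E : \sum_i p i ^+ 2 = (\sum_i #|part P i| ^ 2)%N%:R.
  by rewrite natr_sum; apply: eq_bigr => i _; rewrite natrX.
have sum_p2 : \sum_i p i ^+ 2 <= (1 / r%:R + eps + xi) * n ^+ 2.
  have : 2 * #|edges G|%:R + \sum_i p i ^+ 2 <= n ^+ 2 + #|inner_pairs G P|%:R.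
    by rewrite sum_p2E -natrX -natrM -!natrD ler_nat edges_le_label_graph.
  lra.
have sum_dev2 : \sum_i (p i - n / r%:R) ^+ 2 = \sum_i p i ^+ 2 - n ^+ 2 / r%:R.
  under eq_bigr do rewrite sqrrB.
  rewrite big_split /= sumrB sumrMnl -mulr_suml sum_p sumr_const card_ord.
  rewrite -[_ ^+ 2 *+ _]mulr_natl -/r; field; lra.
have sum_p2_ge : n ^+ 2 / r%:R <= \sum_i p i ^+ 2.
  by rewrite -subr_ge0 -sum_dev2; apply: sumr_ge0 => i _; apply: sqr_ge0.
have dev_le : \sum_i `|p i - n / r%:R| <= delta * n.
  rewrite -(@ler_pXn2r _ 2) ?nnegrE ?sumr_ge0 ?mulr_ge0 ?(ltW n_gt0) //.
  apply: le_trans (sqr_sum_le _ _) _; rewrite card_ord.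
  under eq_bigr do rewrite real_normK ?num_real //.
  rewrite sum_dev2 exprMn; apply: le_trans (ler_wpM2r (sqr_ge0 n) delta_large).
  rewrite -[X in _ <= X]mulrA ler_wpM2l ?(ltW rR_gt0) //.
  have -> : n ^+ 2 / r%:R = 1 / r%:R * n ^+ 2 by field; lra.
  lra.
have moved_le : (\sum_i (#|part P i| - turan_size #|V| i))%N%:R <= delta * n + r%:R.
  apply: le_trans (lerD dev_le (lexx r%:R)).
  rewrite -[X in _ <= _ + X](_ : \sum_(i < r) 1 = _); last by rewrite sumr_const card_ord.
  rewrite natr_sum -big_split /=; apply: ler_sum => i _.
  have size_ge : n / r%:R <= (turan_size #|V| i)%:R + 1.
    rewrite natr1 ler_pdivrMr // -natrM ler_nat /turan_size.
    by apply: ltnW; apply: leq_trans (ltn_ceil _ r_gt0) _; rewrite leq_mul2r ltnS leq_addr orbT.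
  have [le_ps|/ltnW le_sp] := leqP #|part P i| (turan_size #|V| i).
    by move: le_ps; rewrite -subn_eq0 => /eqP->; rewrite addr_ge0.
  rewrite natrB // -/(p i); have := ler_norm (p i - n / r%:R); lra.
have {}diffT : 2 * (edge_diff G T)%:R + 2 * #|edges G|%:R + \sum_i p i ^+ 2 <=
    n ^+ 2 + 2 * #|inner_pairs G P|%:R +
    2 * ((\sum_i (#|part P i| - turan_size #|V| i))%N%:R * n).
  rewrite sum_p2E -!natrM -natrX -!natrD ler_nat.
  by rewrite -big_distrl /= in diffT.
have := ler_wpM2r (ltW n_gt0) moved_le; rewrite mulrDl.
have -> : delta * n * n = delta * n ^+ 2 by rewrite expr2 mulrA.
have nrE : n ^+ 2 / r%:R = 1 / r%:R * n ^+ 2 by field; lra.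
rewrite nrE in sum_p2_ge; lra.
Qed.

End Stability.

(** * Choice of the parameters *)

Section Sizes.
Variable R : realType.

Lemma natr_le_expR m : m%:R <= expR (m%:R : R).
Proof. by apply: le_trans (expR_ge1Dx _); rewrite lerDr. Qed.

Lemma exp2_le_expR m : (2 ^ m)%N%:R <= expR (m%:R : R).
Proof.
rewrite natrX -[m%:R]mulr1 expRM_natl; apply: lerXn2r; rewrite ?nnegrE ?expR_ge0 //.
exact: (expR_ge1Dx 1).
Qed.

Lemma abs_floor_le (x : R) : 0 <= x -> `|Num.floor x|%N%:R <= x.
Proof.
move=> x_ge0; rewrite natr_absz ger0_norm ?floor_ge0 //; exact: floor_le.
Qed.

Lemma abs_floor_gt0 (x : R) : 1 <= x -> (0 < `|Num.floor x|)%N.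
Proof.
move=> x_ge1; rewrite absz_gt0; apply/eqP=> f0.
by have := floor_itv x; rewrite f0 add0r => /andP[_]; rewrite ltNge x_ge1.
Qed.

Lemma abs_ceil_lt (x : R) : 0 <= x -> `|Num.ceil x|%N%:R < x + 1.
Proof.
move=> x_ge0; rewrite natr_absz ger0_norm; last by rewrite ceil_ge0 //; lra.
have /andP[+ _] := ceil_itv x; rewrite rmorphB /=; lra.
Qed.

(** On the scale [n = expR L], the hypotheses bound [q], [q * s] and 1 by
    [a * L / 8] and [q ^ r * s] by [L / 8], so that all products reduce to sums of
    exponents. The first of these holds because [1 / a < a * L]. *)
Lemma blowup_sizes (n q r : nat) (c : R) (a := Num.sqrt c) (L := ln n%:R)
    (s := `|Num.floor (c * L)|%N) (t := `|Num.ceil (n%:R `^ (1 - a))|%N) :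
    (0 < n)%N -> (0 < q)%N -> 0 < c -> c <= 1 -> 1 < c * L ->
    q%:R * a <= 1 / 8 -> q%:R ^+ r * c <= 1 / 8 ->
  [/\ (0 < s)%N, (q * 2 ^ (q ^ r * s) * (q ^ r * s) <= n)%N
    & (t * (q * 2 ^ (q * s)) <= n)%N].
Proof.
move=> n_gt0 q_gt0 c_gt0 c_le1 cL_gt1 qa qrc.
have a_gt0 : 0 < a by rewrite sqrtr_gt0.
have aa : a * a = c by rewrite -expr2 sqr_sqrtr // ltW.
have a_le1 : a <= 1 by rewrite -(@ler_pXn2r _ 2) ?nnegrE ?(ltW a_gt0) // expr1n expr2 aa.
have L_gt0 : 0 < L by rewrite -(pmulr_rgt0 _ c_gt0); lra.
have nE : n%:R = expR L by rewrite lnK // posrE ltr0n.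
have aL_gt0 : 0 < a * L by rewrite mulr_gt0.
have aL_le : a * L <= L by rewrite ger_pMl.
have q_le : q%:R <= a * L / 8.
  have : 0 <= q%:R * (a * a * L - 1) by rewrite mulr_ge0 // aa; lra.
  have := ler_wpM2r (ltW aL_gt0) qa; lra.
have s_le : s%:R <= c * L by apply: abs_floor_le; lra.
have q_ge1 : 1 <= q%:R :> R by rewrite ler1n.
have aL_ge : 8 <= a * L by lra.
split.
- by apply: abs_floor_gt0; lra.
- set Q := (q ^ r * s)%N; rewrite -(ler_nat R) nE 2!natrM.
  have Q_le : Q%:R <= L / 8.
    rewrite natrM natrX.
    apply: le_trans (ler_wpM2l (exprn_ge0 r (ler0n R q)) s_le) _.
    by have := ler_wpM2r (ltW L_gt0) qrc; lra.
  apply: le_trans (_ : _ <= expR q%:R * expR Q%:R * expR Q%:R) _.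
    by rewrite ?ler_pM ?mulr_ge0 ?natr_le_expR ?exp2_le_expR.
  by rewrite -!expRD ler_expR; lra.
rewrite -(ler_nat R) nE !natrM.
set x := n%:R `^ (1 - a) in t *.
have xE : x = expR ((1 - a) * L) by rewrite mulrC expRM -nE.
(* The ceiling costs at most a factor 2 since [x >= 1]. *)
have t_le : t%:R <= 2 * x.
  have x_ge1 : 1 <= x by rewrite xE -[X in X <= _]expR0 ler_expR mulr_ge0 ?subr_ge0 ?(ltW L_gt0).
  have : t%:R < x + 1 := abs_ceil_lt (powR_ge0 _ _).
  by lra.
have qs_le : (q * s)%N%:R <= a * L / 8.
  rewrite natrM; apply: le_trans (ler_wpM2l (ler0n R q) s_le) _.
  by have := ler_wpM2r (ltW aL_gt0) qa; rewrite -aa; lra.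
have two_le : 2 <= expR 1 :> R by apply: (expR_ge1Dx 1).
apply: le_trans (_ : _ <= expR 1 * expR ((1 - a) * L) * (expR q%:R * expR (q * s)%N%:R)) _.
  apply: ler_pM; rewrite ?mulr_ge0 //.
    by apply: le_trans t_le _; rewrite xE ler_wpM2r ?expR_ge0.
  by rewrite ler_pM ?natr_le_expR ?exp2_le_expR.
rewrite -!expRD ler_expR; lra.
Qed.

End Sizes.

(** Here [rho] stands for [r] and [w] for [rho ^ r.+1], which keeps [r] out of the
    exponents, and [rho * g ^ 2] bounds the rounding error [r / n]. The deviation
    of the part sizes is allowed half of the target [e + g]. The other errors
    are cubic in [e] and [g], so the smallness hypotheses absorb their
    coefficients. *)
Lemma near_turan_bounds (R : realFieldType) (rho w g e : R)
    (kappa := 4 * (rho + 1) * g ^+ 3)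
    (xi := 2 * rho ^+ 2 * e ^+ 3 + 6 * (w * (rho + 1) * kappa)) :
    2 <= rho -> 0 <= w -> 0 < g -> 0 < e ->
    e * rho ^+ 8 <= 1 -> w * g * rho ^+ 13 <= 1 -> g * rho ^+ 16 <= 1 ->
  rho * (e ^+ 3 + xi) <= ((e + g) / 2) ^+ 2 /\
  e ^+ 3 / 2 + xi + rho * g ^+ 2 < (e + g) / 2.
Proof.
move=> rho_ge2 w_ge0 g_gt0 e_gt0 e_small wg_small g_small.
have small (x : R) i j m : 0 <= x -> x * rho ^+ m <= 1 -> (i + j <= m)%N ->
    x * rho ^+ i * 2 ^+ j <= 1.
  move=> x_ge0 xm ijm; apply: le_trans xm.
  rewrite -mulrA ler_wpM2l //.
  apply: le_trans (_ : rho ^+ i * rho ^+ j <= _).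
    by rewrite ler_wpM2l ?exprn_ge0 ?lerXn2r ?nnegrE //; lra.
  by rewrite -exprD ler_weXn2l //; lra.
have e3 := small e 3 5 8 (ltW e_gt0) e_small isT.
have e0 := small e 0 8 8 (ltW e_gt0) e_small isT.
have g1 := small g 1 9 16 (ltW g_gt0) g_small isT.
have wg_ge0 : 0 <= w * g by rewrite mulr_ge0 // ltW.
have wg3 := small (w * g) 3 10 13 wg_ge0 wg_small isT.
have r2 : 0 <= rho - 2 by lra.
have r0 : 0 <= rho by lra.
(* The polynomial in [h1] is [rho * (rho ^ 2 - 1)], so that [rho * e ^ 3] is at
   most [rho ^ 3 * e ^ 3]; the one in [h3] is
   [9 * rho ^ 3 - 4 * rho * (rho + 1) ^ 2]. *)
have h1 : 0 <= e ^+ 3 * (rho * ((rho - 2) * (rho + 2) + 3)).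
  by rewrite !mulr_ge0 ?exprn_ge0 ?(ltW e_gt0) //; have := mulr_ge0 r2 r0; lra.
have h2 : 0 <= e ^+ 2 * (1 - e * rho ^+ 3 * 2 ^+ 5).
  by rewrite mulr_ge0 ?exprn_ge0 ?(ltW e_gt0) // subr_ge0.
have h3 : 0 <= w * g * g ^+ 2 * (rho * ((rho - 2) * (5 * rho + 2))).
  by rewrite !mulr_ge0 ?exprn_ge0 ?(ltW g_gt0) //; lra.
have h4 : 0 <= g ^+ 2 * (1 - w * g * rho ^+ 3 * 2 ^+ 10).
  by rewrite mulr_ge0 ?exprn_ge0 ?(ltW g_gt0) // subr_ge0.
have eg_gt0 : 0 < e * g by rewrite mulr_gt0.
have e2_gt0 : 0 < e ^+ 2 by rewrite exprn_gt0.
have g2_gt0 : 0 < g ^+ 2 by rewrite exprn_gt0.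
have main : rho * (e ^+ 3 + xi) <= e ^+ 2 / 8 + g ^+ 2 / 16.
  by rewrite /xi /kappa; lra.
split; first by lra.
have xi_ge0 : 0 <= e ^+ 3 + xi.
  rewrite addr_ge0 ?addr_ge0 ?mulr_ge0 ?exprn_ge0 ?(ltW e_gt0) ?(ltW g_gt0) //; lra.
have h5 : 0 <= (rho - 2) * (e ^+ 3 + xi) by rewrite mulr_ge0.
have h6 : 0 <= e * (1 - e * rho ^+ 0 * 2 ^+ 8) by rewrite mulr_ge0 ?subr_ge0 ?(ltW e_gt0).
have h7 : 0 <= g * (1 - g * rho ^+ 1 * 2 ^+ 9) by rewrite mulr_ge0 ?subr_ge0 ?(ltW g_gt0).
have h8 : 0 <= g ^+ 2 * (rho - 2) by rewrite mulr_ge0 ?exprn_ge0 ?(ltW g_gt0).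
have e3_ge0 : 0 < e ^+ 3 by rewrite exprn_gt0.
(* Halving costs nothing because [rho >= 2]. *)
have main2 : e ^+ 3 / 2 + xi <= (rho * (e ^+ 3 + xi)) / 2 by lra.
lra.
Qed.

Lemma mul_exprn_lt1 (R : realFieldType) (x rho : R) j m : 0 < rho ->
  x ^+ m < rho ^- (m * j) -> x * rho ^+ j < 1.
Proof.
move=> rho_gt0; rewrite -[_^-1]div1r ltr_pdivlMr ?exprn_gt0 //.
rewrite mulnC exprM -exprMn; apply: contraTT.
by rewrite -!leNgt; apply: exprn_ege1.
Qed.

Theorem theorem1 (R : realType) (r n : nat) (c eps : R)
    (V : finType) (G : sgraph V) :
  (2 <= r)%N -> (2 <= n)%N ->
  1 / ln n%:R < c -> c < r%:R ^- (3 * (r + 14) * (r + 1)) ->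
  0 < eps -> eps < r%:R ^- 24 ->
  #|V| = n ->
  #|edges G|%:Z = Num.ceil ((1 - 1 / r%:R - eps) * n%:R ^+ 2 / 2) ->
  contains G (kpart (part_sizes r `|Num.floor (c * ln n%:R)|%N
                                  `|Num.ceil (n%:R `^ (1 - Num.sqrt c))|%N))
  \/
  (exists T : sgraph V, is_turan r n T /\
     (edge_diff G T)%:R <
       (eps `^ (1 / 3) + c `^ (1 / (3 * r + 3)%:R)) * n%:R ^+ 2).
Proof.
move=> r_ge2 n_ge2 c_large c_small eps_gt0 eps_small cardV edgesE.
have n_gt0 : (0 < n)%N by apply: leq_trans n_ge2.
have nR_gt0 : 0 < n%:R :> R by rewrite ltr0n.
have rho_ge2 : 2 <= r%:R :> R by rewrite (ler_nat R 2).
have rho_gt0 : 0 < r%:R :> R by lra.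
have ln_gt0 : 0 < ln (n%:R : R) by rewrite ln_gt0 // (ltr_nat R 1).
have c_gt0 : 0 < c by apply: lt_trans c_large; rewrite divr_gt0.
have cL : 1 < c * ln n%:R by rewrite -ltr_pdivrMr.
set g := c `^ _; set e := eps `^ _.
have g_gt0 : 0 < g by rewrite powR_gt0.
have e_gt0 : 0 < e by rewrite powR_gt0.
have gE : g ^+ (3 * r + 3) = c.
  by rewrite -powR_mulrn ?ltW // -powRrM mul1r mulVf ?powRr1 ?ltW // pnatr_eq0 addnS.
have eE : e ^+ 3 = eps.
  by rewrite -powR_mulrn ?ltW // -powRrM mul1r mulVf ?powRr1 ?ltW // pnatr_eq0.
have e_rho : e * r%:R ^+ 8 < 1 by apply: (@mul_exprn_lt1 _ _ _ _ 3); rewrite ?eE.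
have g_rho : g * r%:R ^+ (r + 14) < 1.
  have expE : (3 * (r + 14) * (r + 1) = (3 * r + 3) * (r + 14))%N.
    by rewrite mulnAC [(3 * (r + 1))%N]mulnDr muln1.
  rewrite expE in c_small; apply: (@mul_exprn_lt1 _ _ _ (r + 14) (3 * r + 3)) rho_gt0 _.
  by rewrite gE; exact: c_small.
clearbody e g.
have rho_ge1 : 1 <= r%:R :> R by lra.
have pow_le j m : (j <= m)%N -> (r%:R : R) ^+ j <= r%:R ^+ m.
  by move=> jm; rewrite ler_weXn2l.
have g_rho16 : g * r%:R ^+ 16 <= 1.
  apply: ltW; apply: le_lt_trans g_rho; rewrite ler_wpM2l ?(ltW g_gt0) // pow_le //.
  exact: (leq_add r_ge2 (leqnn 14)).
have wg_rho : r%:R ^+ r.+1 * g * r%:R ^+ 13 <= 1.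
  by rewrite mulrAC -exprD mulrC addSnnS ltW.
have g_le : g <= 1 / 64.
  have : 2 ^+ 16 <= r%:R ^+ 16 :> R by rewrite lerXn2r ?nnegrE //; lra.
  by move/(ler_wpM2l (ltW g_gt0)); lra.
have g_le1 : g <= 1 by lra.
have g3_le : g ^+ 3 <= 1 / 64.
  by rewrite exprS; apply: le_trans g_le; rewrite ger_pMr // exprn_ile1 // ltW.
have g3_gt0 : 0 < g ^+ 3 by rewrite exprn_gt0.
(* Here [c = g ^ (3r + 3)] with [3r + 3 >= 9]. *)
have c_le : c <= g ^+ 3 ^+ 3.
  rewrite -exprM -gE; apply: ler_wiXn2l; [exact: ltW|exact: g_le1|].
  exact: (leq_add (leq_mul (leqnn 3) r_ge2) (leqnn 3)).
(* The upper bound on [q] keeps the part sizes small in the first case; the lower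
   bound turns the failure of that case into a small clique density. *)
pose q := Num.truncn (g ^- 3).
have /andP[q_le q_gt] : q%:R <= g ^- 3 < q.+1%:R.
  by apply: truncn_itv; rewrite invr_ge0 ltW.
have qg_le : q%:R * g ^+ 3 <= 1 by rewrite -ler_pdivlMr // mul1r.
have qg_ge : 1 / 2 <= q%:R * g ^+ 3.
  move: q_gt; rewrite -natr1 -(ltr_pM2r g3_gt0) mulVf ?gt_eqF //; lra.
have q_gt0 : (0 < q)%N.
  by rewrite lt0n; apply: contraTneq qg_ge => ->; rewrite mul0r -ltNge divr_gt0.
have many_edges : (1 - 1 / r%:R - eps) * #|V|%:R ^+ 2 <= 2 * #|edges G|%:R.
  have := ceil_ge ((1 - 1 / r%:R - eps) * n%:R ^+ 2 / 2).
  rewrite -edgesE cardV -pmulrn; lra.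
have [many|few] := leqP (2 * r.+1 * #|V| ^ r.+1) (q * #|cliques G r.+1|).
  left; have [|||s_gt0 V_large t_small] := @blowup_sizes R n q r c n_gt0 q_gt0 c_gt0 _ cL.
  - by apply: le_trans c_le _; rewrite exprn_ile1 ?(ltW g3_gt0) //; lra.
  - rewrite -(@ler_pXn2r _ 2) ?nnegrE ?mulr_ge0 ?sqrtr_ge0 ?divr_ge0 ?invr_ge0 //.
    rewrite exprMn sqr_sqrtr ?(ltW c_gt0) //.
    apply: le_trans (ler_wpM2l (exprn_ge0 2 (ler0n R q)) c_le) _.
    rewrite [g ^+ 3 ^+ 3]exprSr mulrA -exprMn.
    apply: le_trans (ler_piMl (ltW g3_gt0) (exprn_ile1 2 _ qg_le)) _.
      by rewrite mulr_ge0 // ltW.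
    by apply: le_trans g3_le _; lra.
  - have -> : c = g ^+ 3 ^+ r * g ^+ 3 by rewrite -exprM -exprD.
    rewrite mulrA -exprMn.
    apply: le_trans (ler_piMl (ltW g3_gt0) (exprn_ile1 r _ qg_le)) _.
      by rewrite mulr_ge0 // ltW.
    by apply: le_trans g3_le _; lra.
  by apply: many_cliques_contain many; rewrite ?cardV.
right.
pose kappa := 4 * (r%:R + 1) * g ^+ 3.
have kappa_ge0 : 0 <= kappa.
  by apply: mulr_ge0 (ltW g3_gt0); apply: mulr_ge0 => //; apply: addr_ge0.
have eps_small3 : r%:R ^+ 3 * eps <= 1 / 2.
  have eps24 : eps * r%:R ^+ 24 < 1.
    by rewrite -ltr_pdivlMr ?exprn_gt0 // div1r.
  have : eps * (r%:R ^+ 3 * 2) <= eps * r%:R ^+ 24.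
    rewrite ler_wpM2l ?(ltW eps_gt0) //; apply: le_trans (pow_le 4%N 24%N isT).
    by rewrite [X in _ <= X]exprSr ler_wpM2l // exprn_ge0 // ltW.
  lra.
have few_cliques : #|cliques G r.+1|%:R <= kappa * #|V|%:R ^+ r.+1.
  have {}few : q%:R * #|cliques G r.+1|%:R <= 2 * (r%:R + 1) * #|V|%:R ^+ r.+1 :> R.
    by rewrite natr1 -natrX -!natrM ler_nat ltnW.
  have := ler_wpM2l (ltW g3_gt0) few.
  have := ler_wpM2r (ler0n R #|cliques G r.+1|) qg_ge.
  by rewrite /kappa; lra.
have [delta_large total_small] := near_turan_bounds rho_ge2
  (exprn_ge0 r.+1 (ltW rho_gt0)) g_gt0 e_gt0 (ltW e_rho) wg_rho g_rho16.
have [s rE] : exists s, r = s.+1 by exists r.-1; rewrite prednK // (leq_trans _ r_ge2).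
have V_gt0 : (0 < #|V|)%N by rewrite cardV.
have delta_ge0 : 0 <= (e + g) / 2 by lra.
have xiE : 2 * r%:R ^+ 2 * eps + 6 * r%:R ^+ r.+1 * r.+1%:R * kappa =
    2 * r%:R ^+ 2 * e ^+ 3 + 6 * (r%:R ^+ r.+1 * (r%:R + 1) * kappa).
  by rewrite eE -natr1; ring.
rewrite -/kappa -xiE in delta_large total_small; subst r.
rewrite eE in delta_large total_small.
have [T [T_turan diffT]] := stability_few_cliques V_gt0 eps_gt0 kappa_ge0
  eps_small3 many_edges few_cliques delta_ge0 delta_large.
exists T; rewrite -cardV; split=> //; apply: le_lt_trans diffT _.
rewrite cardV.
(* The rounding error: [c * n > c * ln n > 1], and [c <= g ^ 2]. *)
have n_large : 1 <= g ^+ 2 * n%:R.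
  apply: (@le_trans _ _ (c * n%:R)).
    apply: ltW; apply: lt_trans cL _; rewrite ltr_pM2l //.
    by apply: ln_sublinear.
  rewrite ler_wpM2r ?ler0n // -gE; apply: ler_wiXn2l; [exact: ltW|exact: g_le1|].
  exact: (leq_trans _ (leq_addl _ _)).
have := ler_wpM2l (ltW (mulr_gt0 rho_gt0 nR_gt0)) n_large.
have n2_gt0 : 0 < (n%:R : R) ^+ 2 by rewrite exprn_gt0.
move: total_small; rewrite -(ltr_pM2r n2_gt0).
lra.
Qed.
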